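(* Let $\mathcal{H}$ be a complex Hilbert space and let $A,B\in\mathcal{B}(\mathcal{H})$. Then for all real $r\geq1$, $$ w^{2r}(B^*A)\leq\frac{1}{2}\,w^{2}\left(|A|^{2r}+\mathrm{i}\,|B|^{2r}\right). $$
   Context: $\mathcal{B}(\mathcal{H})$ denotes the $C^*$-algebra of bounded linear operators on the complex Hilbert space $\mathcal{H}$. For $T\in\mathcal{B}(\mathcal{H})$, $|T|=(T^*T)^{1/2}$, and powers of $|T|$ are taken by the continuous functional calculus. The numerical radius is $w(T)=\sup\{|\langle Tx,x\rangle|: x\in\mathcal{H},\ \|x\|=1\}$, and $w^{s}(T)=(w(T))^{s}$. Here $\mathrm{i}$ is the imaginary unit. *)

(* Defs.v *)
From HB Require Import structures.
From mathcomp Require Import all_boot all_order all_algebra.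
From mathcomp Require Import sesquilinear complex.
From mathcomp Require Import all_classical all_reals all_analysis.

Set Implicit Arguments.
Unset Strict Implicit.
Unset Printing Implicit Defensive.

Import Order.TTheory GRing.Theory Num.Theory.
Import numFieldNormedType.Exports.

Local Open Scope classical_set_scope.
Local Open Scope ring_scope.
Local Open Scope complex_scope.

(* An operator on [H] is represented by its underlying map [H -> H]. *)
Section Operators.
Context {R : realType} {H : normedModType R[i]}.
Implicit Types (T S : H -> H) (f : R -> R).

Definition bounded_op : set (H -> H) :=
  [set T | linear T /\ exists M : R, forall x, `|T x| <= M%:C * `|x|].

Definition spectrum T : set R[i] :=
  [set l | ~ exists2 S, bounded_op S &
     cancel (fun x => T x - l *: x) S /\ cancel S (fun x => T x - l *: x)].

Definition poly_op (p : {poly R}) T : H -> H :=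
  fun x => \sum_(i < size p) (p`_i)%:C *: iter i T x.

(* For bounded operators this is convergence in the operator norm. *)
Definition op_cvg (U : nat -> H -> H) S :=
  forall e : R, 0 < e ->
    \forall n \near \oo, forall x, `|U n x - S x| <= e%:C * `|x|.

(* Continuous functional calculus of a self-adjoint bounded operator [T]: its
   spectrum is real, a function [f] which is continuous on it is there a uniform
   limit of polynomials [p n], and [f(T)] is the norm limit of the [p n (T)],
   which does not depend on the choice of the [p n]. *)
Definition is_cfc f T S :=
  bounded_op S /\
  exists2 p : nat -> {poly R},
    {uniform [set t : R | spectrum T t%:C],
       (fun n t => (p n).[t]) @ \oo --> f} &
    op_cvg (fun n => poly_op (p n) T) S.

Definition cfc f T : H -> H := xget (fun=> 0) [set S | is_cfc f T S].

(* Real powers, for [T] positive and [s > 0]; then [spectrum T] lies in the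
   nonnegative reals, so that the values of [powR] at [t < 0] do not matter. *)
Definition op_powR T (s : R) : H -> H := cfc (fun t => t `^ s) T.

End Operators.

Section InnerProduct.
Context {R : realType} {H : normedModType R[i]}.
(* [dot x y] is linear in [x] and conjugate-linear in [y]. *)
Variable dot : {dot H for Num.conj}.
Implicit Types T : H -> H.

Definition is_adjoint T S :=
  bounded_op S /\ forall x y, dot (T x) y = dot x (S y).

Definition adjoint T : H -> H := xget (fun=> 0) [set S | is_adjoint T S].

Definition op_abs T : H -> H := op_powR (adjoint T \o T) 2^-1.

(* The supremum of the empty set, for [H] trivial, is [0]. *)
Definition numerical_radius T : R :=
  sup [set Normc.normc (dot (T x) x) | x in [set x : H | `|x| = 1]].

End InnerProduct.

(* Main.v *)
(** For a unit vector [x], Cauchy-Schwarz gives [|<B*Ax, x>| <= |Ax| |Bx|].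
    Since [| |A|x | = |Ax|], McCarthy's inequality gives
    [|Ax|^(2r) <= a := <|A|^(2r) x, x>], and likewise [|Bx|^(2r) <= b].  Hence
    [|<B*Ax, x>|^(2r) <= a b <= (a^2 + b^2) / 2], where [a^2 + b^2] is the square
    of the modulus of [<(|A|^(2r) + i |B|^(2r)) x, x>].

    The functional calculus rests on one fact: a real polynomial [q] which is
    nonnegative on the real spectrum of a self-adjoint [T] satisfies [q(T) >= 0].
    Otherwise the infimum [m < 0] of the form of [q(T)] makes [q(T) - m] fail to
    be bounded below; factoring [q - m] over the complex numbers, some [T - z]
    fails to be bounded below, so that [z] is real, lies in the spectrum and
    satisfies [q(z) = m].  Applied to [c^2 - q^2] this bounds the norm of [q(T)]
    by the supremum of [|q|] on the spectrum, and Weierstrass approximation of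
    the powers yields the existence of the calculus. *)

Require Import Defs.
From mathcomp Require Import all_boot all_order all_algebra.
From mathcomp Require Import sesquilinear complex ring lra.
From mathcomp Require Import all_classical all_reals all_analysis.

Import Order.TTheory GRing.Theory Num.Theory.
Import numFieldNormedType.Exports.
Local Open Scope ring_scope.
Local Open Scope complex_scope.

(** * Elementary inequalities on quadratics and squares *)

Lemma quad_ge0_discr (R : realFieldType) (a b c : R) :
  0 <= a -> (forall t, 0 <= a * t ^+ 2 + 2 * b * t + c) -> b ^+ 2 <= a * c.
Proof.
rewrite le_eqVlt => /predU1P[<-|a0] h.
  have [->|b0] := eqVneq b 0; first by rewrite expr0n mul0r.
  (* For [a = 0] the polynomial is affine of slope [2 * b], and this point gives it the value -1. *)
  have := h (- (c + 1) / (2 * b)).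
  suff -> : 0 * (- (c + 1) / (2 * b)) ^+ 2 + 2 * b * (- (c + 1) / (2 * b)) + c = -1 by lra.
  by field.
have := h (- b / a).
have -> : a * (- b / a) ^+ 2 + 2 * b * (- b / a) + c = (a * c - b ^+ 2) / a.
  by field; rewrite gt_eqF.
by rewrite pmulr_lge0 ?invr_gt0// subr_ge0.
Qed.

Lemma sqr_le_norm (R : realDomainType) (a b : R) : 0 <= b -> a ^+ 2 <= b ^+ 2 -> `|a| <= b.
Proof.
move=> b0 h; rewrite -(@ler_pXn2r _ 2)// ?nnegrE//.
by rewrite real_normK ?num_real.
Qed.

Lemma sqr_le (R : realDomainType) (a b : R) : 0 <= b -> a ^+ 2 <= b ^+ 2 -> a <= b.
Proof. by move=> b0 /(sqr_le_norm _ _ _ b0); apply: le_trans; rewrite ler_norm. Qed.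

(** * Polynomial approximation of powers *)

(* De Casteljau's recursion for [\sum_k g k 'C(n, k) 'X^k (1 - 'X)^(n - k)]: it
   turns the moments of the binomial law into inductions without binomials. *)
Fixpoint bernstein (R : nzRingType) (n : nat) (g : nat -> R) : {poly R} :=
  if n is m.+1 then
    'X * bernstein R m (fun k => g k.+1) + (1 - 'X) * bernstein R m g
  else (g 0%N)%:P.

Lemma bernstein_le (R : realFieldType) n (g h : nat -> R) (x : R) :
  0 <= x <= 1 -> (forall k, (k <= n)%N -> g k <= h k) ->
  (bernstein R n g).[x] <= (bernstein R n h).[x].
Proof.
move=> /andP[x0 x1]; elim: n g h => [|n IH] g h gh; first by rewrite !hornerC gh.
rewrite /= !hornerE lerD// ler_wpM2l ?subr_ge0//; apply: IH => k kn; apply: gh => //.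
exact: leqW.
Qed.

(* The case [b = - n x] is the variance of the binomial law. *)
Lemma bernstein_quadratic (R : realFieldType) n (a b c x : R) :
  (bernstein R n (fun k => a + c * (k%:R + b) ^+ 2)).[x] =
  a + c * ((n%:R * x + b) ^+ 2 + n%:R * x * (1 - x)).
Proof.
elim: n b => [|n IH] b; first by rewrite /= hornerC !mul0r addr0.
rewrite /= !hornerE IH.
have -> : (bernstein R n (fun k => a + c * (k.+1%:R + b) ^+ 2)).[x] =
    (bernstein R n (fun k => a + c * (k%:R + (1 + b)) ^+ 2)).[x].
  by congr (_.[x]); congr bernstein; apply/funext => k; rewrite -natr1 addrA.
by rewrite IH -natr1; ring.
Qed.

(** Bernstein's proof: |f(k/n) - f(x)| is at most e/2 plus a multiple of (k - n x)^2, by uniform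
    continuity if k/n is within [d] of [x], and by the bound 2K otherwise. Averaging turns (k - n
    x)^2 into the variance n x (1 - x). *)
Lemma weierstrass_unit (R : archiRealFieldType) (f : R -> R) (K : R) :
  (forall x : R, 0 <= x <= 1 -> `|f x| <= K) ->
  (forall e : R, 0 < e -> exists2 d : R, 0 < d & forall x y : R, 0 <= x <= 1 -> 0 <= y <= 1 ->
     `|x - y| <= d -> `|f x - f y| <= e) ->
  forall e : R, 0 < e -> exists p : {poly R}, forall x : R, 0 <= x <= 1 -> `|p.[x] - f x| <= e.
Proof.
move=> fK fu e e0.
have [d d0 hd] := fu (e / 2) (divr_gt0 e0 (ltr0Sn _ 1)).
have K0 : 0 <= K by apply: le_trans (fK 0 _); rewrite ?lexx ?ler01.
have d20 : 0 < d ^+ 2 by rewrite exprn_gt0.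
(* This size makes the averaged quadratic term, at most 2K / (d^2 n), no larger than e/2. *)
pose n := (Num.bound (4 * K / (e * d ^+ 2))).+1.
have nK : 2 * K / d ^+ 2 / n%:R <= e / 2.
  have : 4 * K / (e * d ^+ 2) < n%:R.
    rewrite (lt_le_trans (archi_boundP _))// ?ler_nat ?leqnSn//.
    by apply: divr_ge0; rewrite mulr_ge0// ltW.
  rewrite ltr_pdivrMr ?mulr_gt0// => h.
  rewrite !ler_pdivrMr ?ltr0n//; nra.
have n0 : 0 < n%:R :> R by rewrite ltr0n.
exists (bernstein R n (fun k => f (k%:R / n%:R))) => x x01.
pose c := 2 * K / d ^+ 2 / n%:R ^+ 2.
have c0 : 0 <= c by apply: divr_ge0; [apply: divr_ge0; rewrite ?mulr_ge0// ltW|exact: sqr_ge0].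
have key k : (k <= n)%N ->
    `|f (k%:R / n%:R) - f x| <= e / 2 + c * (k%:R + - (n%:R * x)) ^+ 2.
  move=> kn.
  have k01 : 0 <= (k%:R / n%:R : R) <= 1.
    by rewrite divr_ge0//= ler_pdivrMr// mul1r ler_nat.
  have [h|h] := leP `|k%:R / n%:R - x| d.
    by rewrite (le_trans (hd _ _ k01 x01 h))// lerDl mulr_ge0 ?sqr_ge0.
  apply: (@le_trans _ _ (2 * K)).
    by apply: (le_trans (ler_normB _ _)); have := fK _ k01; have := fK _ x01; lra.
  apply: ler_wpDl; first by rewrite divr_ge0 ?ltW.
  have -> : c * (k%:R + - (n%:R * x)) ^+ 2 = 2 * K * ((k%:R / n%:R - x) ^+ 2 / d ^+ 2).
    by rewrite /c; field; rewrite !gt_eqF.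
  rewrite ler_peMr ?mulr_ge0// ler_pdivlMr// mul1r.
  rewrite -[leRHS]real_normK ?num_real// ler_pXn2r ?nnegrE//; exact: ltW.
have bq a s : (bernstein R n (fun k => a + s * (k%:R + - (n%:R * x)) ^+ 2)).[x]
    = a + s * (n%:R * x * (1 - x)).
  by rewrite bernstein_quadratic subrr expr0n add0r.
have cn : c * (n%:R * x * (1 - x)) <= e / 2.
  apply: le_trans nK; have -> : c * (n%:R * x * (1 - x)) = 2 * K / d ^+ 2 / n%:R * (x * (1 - x)).
    by rewrite /c; field; rewrite !gt_eqF.
  apply: ler_piMr; last by move/andP: x01 => [? ?]; nra.
  by apply: divr_ge0; [apply: divr_ge0; rewrite ?mulr_ge0// ltW|exact: ltW].
have up : (bernstein R n (fun k => f (k%:R / n%:R))).[x] <=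
    f x + e / 2 + c * (n%:R * x * (1 - x)).
  rewrite -bq; apply: bernstein_le => // k /key; rewrite ler_norml => /andP[_]; lra.
have lo : f x - e / 2 + (- c) * (n%:R * x * (1 - x)) <=
    (bernstein R n (fun k => f (k%:R / n%:R))).[x].
  rewrite -bq; apply: bernstein_le => // k /key; rewrite ler_norml => /andP[+ _]; lra.
rewrite ler_norml; apply/andP; split; lra.
Qed.

(* Young's inequality for [u] and [l `^ (r - 1)]. *)
Lemma powR_tangent (R : realType) (r u l : R) : 1 <= r -> 0 <= u -> 0 <= l ->
  r * l `^ (r - 1) * u - (r - 1) * l `^ r <= u `^ r.
Proof.
rewrite le_eqVlt => /predU1P[<-|r1] u0 l0.
  by rewrite subrr powRr0 mul0r subr0 !mul1r powRr1.
have r0 : 0 < r by apply: lt_trans r1.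
have r10 : 0 < r - 1 by rewrite subr_gt0.
have := @conjugate_powR R u (l `^ (r - 1)) r (r / (r - 1)) u0 (powR_ge0 _ _) r0
  (divr_gt0 r0 r10).
have -> : r^-1 + (r / (r - 1))^-1 = 1 by field; rewrite !gt_eqF.
move=> /(_ erefl); rewrite -powRrM.
have -> : (r - 1) * (r / (r - 1)) = r by field; rewrite gt_eqF.
have -> : u `^ r / r + l `^ r / (r / (r - 1)) = (u `^ r + (r - 1) * l `^ r) / r.
  by field; rewrite !gt_eqF.
by rewrite ler_pdivlMr//; lra.
Qed.

Lemma powR_le1 (R : realType) (x s : R) : 0 <= x <= 1 -> 0 <= s -> x `^ s <= 1.
Proof.
move=> /andP[x0 x1] s0; rewrite [leRHS](_ : 1 = 1 `^ s); last by rewrite powR1.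
by rewrite ge0_ler_powR ?nnegrE ?ler01.
Qed.

(** The exponents allowed are those that occur: 1/2 for |T| and 2r for the powers of |T|. Uniform
    continuity is shown on [0, 1], and a rescaling by [M] leads to [0, M]. *)
Lemma powR_approx (R : realType) (M s : R) : 0 < M -> s = 2^-1 \/ 1 <= s ->
  forall e : R, 0 < e -> exists p : {poly R}, forall t : R, 0 <= t <= M -> `|p.[t] - t `^ s| <= e.
Proof.
move=> M0 hs e e0.
have s0 : 0 < s by case: hs => [->|/(lt_le_trans ltr01)//]; rewrite invr_gt0.
have pow1 (x : R) : 0 <= x <= 1 -> 0 <= x `^ s <= 1.
  by move=> x01; rewrite powR_ge0 powR_le1// ltW.
have unif : forall e : R, 0 < e -> exists2 d, 0 < d & forall x y : R, 0 <= x <= 1 -> 0 <= y <= 1 ->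
     `|x - y| <= d -> `|x `^ s - y `^ s| <= e.
  move=> {}e {}e0.
  suff [d d0 hd] : exists2 d : R, 0 < d & forall x y : R, 0 <= x <= 1 -> 0 <= y <= 1 ->
      y <= x -> x - y <= d -> x `^ s - y `^ s <= e.
    have sle (x y : R) : 0 <= y -> y <= x -> y `^ s <= x `^ s.
      by move=> y0 yx; apply: ge0_ler_powR; rewrite ?nnegrE//; [exact: ltW|exact: le_trans yx].
    exists d => // x y x01 y01; have /andP[x0 _] := x01; have /andP[y0 _] := y01.
    have [yx|/ltW xy] := leP y x.
      by rewrite !ger0_norm ?subr_ge0 ?sle//; exact: hd.
    by rewrite !ler0_norm ?subr_le0 ?sle// !opprB; exact: hd.
  case: hs => [->|s1].
    (* The square root satisfies sqrt x - sqrt y <= sqrt (x - y), so e^2 works. *)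
    exists (e ^+ 2) => [|x y /andP[x0 _] /andP[y0 _] _ h]; first by rewrite exprn_gt0.
    rewrite !powR12_sqrt// lerBlDl.
    apply: sqr_le; first by rewrite addr_ge0 ?sqrtr_ge0// ltW.
    rewrite sqrrD !sqr_sqrtr//.
    have := sqrtr_ge0 y; nra.
  (* The tangent at [x] lies below the power at [y], so x^s - y^s <= s x^(s-1) (x - y) <= s (x -
     y). *)
  exists (e / s) => [|x y /andP[x0 x1] /andP[y0 y1] yx]; first by rewrite divr_gt0.
  rewrite ler_pdivlMr// => h.
  have [x00|xn0] := eqVneq x 0.
    by rewrite x00 powR0 ?gt_eqF// sub0r; have := powR_ge0 y s; lra.
  have := powR_tangent R s y x s1 y0 x0.
  have xs : x `^ s = x `^ (s - 1) * x.
    by rewrite mulrC mulr_powRB1.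
  have : x `^ (s - 1) <= 1.
    by apply: powR_le1; rewrite ?x0// subr_ge0.
  have := powR_ge0 x (s - 1).
  rewrite xs; move: (x `^ (s - 1)) (y `^ s) => a b a0 a1 hh.
  apply: (@le_trans _ _ (a * ((x - y) * s))); first by lra.
  apply: le_trans h; apply: ler_piMl => //; apply: mulr_ge0; [by rewrite subr_ge0|exact: ltW].
have Ms0 : 0 < M `^ s by rewrite powR_gt0.
have [|p hp] := weierstrass_unit R (fun x => x `^ s) 1 _ unif (e / M `^ s) (divr_gt0 e0 Ms0).
  by move=> x /pow1/andP[x0 x1]; rewrite ger0_norm.
exists (M `^ s *: (p \Po (M^-1 *: 'X))) => t /andP[t0 tM].
have iM0 : 0 <= M^-1 by rewrite invr_ge0 ltW.
have tM0 : 0 <= M^-1 * t by rewrite mulr_ge0.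
have tM01 : 0 <= M^-1 * t <= 1 by rewrite tM0 mulrC ler_pdivrMr ?mul1r.
have tE : t `^ s = M `^ s * (M^-1 * t) `^ s.
  by rewrite -powRM// ?mulrA ?divff ?mul1r ?gt_eqF// ltW.
rewrite tE !hornerE horner_comp !hornerE -mulrBr normrM ger0_norm ?powR_ge0//.
by rewrite mulrC -ler_pdivlMr// hp.
Qed.

(** * Passages to the limit *)

Lemma uniform_cvg_natP (R : realType) (A : set R) (F : nat -> R -> R) (f : R -> R) :
  {uniform A, (F @ \oo)%classic --> f}%classic <->
  forall e : R, 0 < e -> exists N, forall n, (N <= n)%N ->
    forall t, A t -> `|F n t - f t| <= e.
Proof.
split => [Ff e e0|hF P /uniform_nbhs [E [entE EP]]].
  have : nbhs (f : {uniform` A -> R}) [set g | forall t, A t -> `|g t - f t| <= e]%classic.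
    apply/uniform_nbhs; exists [set xy | ball xy.1 e xy.2]%classic; split.
      by rewrite -entourage_ballE; exists e.
    by move=> g gE t /gE; rewrite /= -ball_normE /= distrC => /ltW.
  by move=> /Ff [N _ hN]; exists N => n /hN.
move: entE; rewrite -entourage_ballE => -[e /= e0 eE].
have [N hN] := hF _ (divr_gt0 e0 (ltr0Sn _ 1)).
exists N => // n /= /hN h; apply: EP => t /h ht /=; apply: eE => /=.
rewrite -ball_normE /= distrC (le_lt_trans ht)//.
by rewrite ltr_pdivrMr// ltr_pMr// ltr1n.
Qed.

(** Lets an error of order e vanish: a positive [a] would contradict e = min(1, a/(2C)). The bound e
    <= 1 allows terms in e^2 to be absorbed into [C]. *)
Lemma scaled_small_le0 (R : realFieldType) (a C : R) :
  (forall e, 0 < e -> e <= 1 -> a <= e * C) -> a <= 0.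
Proof.
move=> h; rewrite leNgt; apply/negP => a0.
have C0 : 0 < C by have := h 1 ltr01 (lexx 1); rewrite mul1r; exact: lt_le_trans.
have d0 : 0 < a / (2 * C) by rewrite divr_gt0// mulr_gt0.
have := h (Num.min 1 (a / (2 * C))); rewrite lt_min ltr01 d0 ge_min lexx => /(_ isT isT).
apply/negP; rewrite -ltNge.
apply: (@le_lt_trans _ _ (a / (2 * C) * C)); first by rewrite ler_pM2r// ge_min lexx orbT.
have -> : a / (2 * C) * C = a / 2 by field; rewrite gt_eqF.
by rewrite ltr_pdivrMr// ltr_pMr// ltr1n.
Qed.

(** * Operators on a Hilbert space *)

Section Hilbert.
Context {R : realType} {H : completeNormedModType R[i]}.
Variable dot : {dot H for Num.conj}.
Hypothesis dotE : forall x : H, dot x x = `|x| ^+ 2.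
Implicit Types (x y h : H) (T P : H -> H) (t : R) (k : R[i]).

(** The norm of [H] takes its values in [R[i]], although they are real; [nr] moves it to [R], where
    real powers and linear arithmetic apply. *)
Definition nr x : R := complex.Re `|x|.
(** A real inner product with the same norm; the complex one is recovered from it through
    [dot_rdot]. *)
Definition rdot x y : R := complex.Re (dot x y).

Lemma nrE x : `|x| = (nr x)%:C.
Proof.
have := normr_ge0 x; rewrite /nr; case: `|x| => a b.
by rewrite lecE /= => /andP[/eqP -> _].
Qed.

Lemma nr_ge0 x : 0 <= nr x.
Proof. by have := normr_ge0 x; rewrite nrE lecR. Qed.

Lemma nr0_eq0 x : nr x = 0 -> x = 0.
Proof. by move=> x0; apply/eqP; rewrite -normr_eq0 nrE x0. Qed.

Lemma nr0 : nr 0 = 0.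
Proof. by rewrite /nr normr0. Qed.

Lemma nrD x y : nr (x + y) <= nr x + nr y.
Proof. by have := ler_normD x y; rewrite !nrE -rmorphD lecR. Qed.

Lemma nrN x : nr (- x) = nr x.
Proof. by rewrite /nr normrN. Qed.

Lemma nrBC x y : nr (x - y) = nr (y - x).
Proof. by rewrite /nr distrC. Qed.

Lemma nrZ k x : nr (k *: x) = Normc.normc k * nr x.
Proof.
by have := normrZ k x; rewrite !nrE (_ : `|k| = (Normc.normc k)%:C)// -rmorphM => -[].
Qed.

Lemma normcR t : Normc.normc t%:C = `|t|.
Proof. by rewrite /= expr0n addr0 sqrtr_sqr. Qed.

Lemma nrZR t x : nr (t%:C *: x) = `|t| * nr x.
Proof. by rewrite nrZ normcR. Qed.

Lemma dotC x y : dot x y = (dot y x)^*%C.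
Proof. by rewrite [LHS](@hermC _ _ _ _ dot) expr0 mul1r. Qed.

Lemma rdotC x y : rdot x y = rdot y x.
Proof. by rewrite /rdot dotC; case: (dot y x). Qed.

Lemma rdotDl x y h : rdot (x + y) h = rdot x h + rdot y h.
Proof. by rewrite /rdot linearDl/=; case: (dot x h) => a b; case: (dot y h). Qed.

Lemma rdotDr x y h : rdot h (x + y) = rdot h x + rdot h y.
Proof. by rewrite ![rdot h _]rdotC rdotDl. Qed.

Lemma rdotZl t x y : rdot (t%:C *: x) y = t * rdot x y.
Proof. by rewrite /rdot linearZl_LR /=; case: (dot x y) => a b /=; rewrite mul0r subr0. Qed.

Lemma rdotZr t x y : rdot x (t%:C *: y) = t * rdot x y.
Proof. by rewrite rdotC rdotZl rdotC. Qed.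

Lemma rdotNl x y : rdot (- x) y = - rdot x y.
Proof. by rewrite /rdot linearNl/=; case: (dot x y). Qed.

Lemma rdotBl x y h : rdot (x - y) h = rdot x h - rdot y h.
Proof. by rewrite rdotDl rdotNl. Qed.

Lemma rdotBr x y h : rdot h (x - y) = rdot h x - rdot h y.
Proof. by rewrite ![rdot h _]rdotC rdotBl. Qed.

Lemma rdot_nr x : rdot x x = nr x ^+ 2.
Proof. by rewrite /rdot dotE nrE -rmorphXn. Qed.

Lemma linD T : linear T -> {morph T : x y / x + y}.
Proof. by move=> lT x y; have := lT 1 x y; rewrite !scale1r. Qed.

Lemma lin0 T : linear T -> T 0 = 0.
Proof. by move=> lT; have := lT (-1) 0 0; rewrite !scaleN1r oppr0 addr0 addNr. Qed.

Lemma linZ T k : linear T -> {morph T : x / k *: x}.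
Proof. by move=> lT x; have := lT k x 0; rewrite (lin0 _ lT) !addr0. Qed.

Lemma linB T : linear T -> {morph T : x y / x - y}.
Proof. by move=> lT x y; rewrite linD// -scaleN1r linZ// scaleN1r. Qed.

Definition selfadj T := forall x y, dot (T x) y = dot x (T y).

Lemma selfadjr T x y : selfadj T -> rdot (T x) y = rdot x (T y).
Proof. by rewrite /rdot => ->. Qed.

Lemma rdotZZ T t x : linear T -> rdot (T (t%:C *: x)) (t%:C *: x) = t ^+ 2 * rdot (T x) x.
Proof. by move=> lT; rewrite linZ// rdotZl rdotZr mulrA. Qed.

(** The form of [P] at x + t y is a quadratic in t that is never negative, so its discriminant is
    not positive. *)
Lemma psd_cauchy_schwarz P x y : linear P -> selfadj P ->
  (forall h, 0 <= rdot (P h) h) ->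
  rdot (P x) y ^+ 2 <= rdot (P x) x * rdot (P y) y.
Proof.
move=> lP sP P0; rewrite mulrC; apply: quad_ge0_discr => // t.
have := P0 (x + t%:C *: y).
rewrite linD// linZ// !(rdotDl, rdotDr, rdotZl, rdotZr).
by rewrite (selfadjr _ y x sP) (rdotC y) expr2; lra.
Qed.

Lemma cauchy_schwarz x y : `|rdot x y| <= nr x * nr y.
Proof.
rewrite -(@ler_pXn2r _ 2)// ?nnegrE ?mulr_ge0 ?nr_ge0// real_normK ?num_real//.
rewrite exprMn -!rdot_nr; apply: (@psd_cauchy_schwarz id) => // h.
by rewrite rdot_nr sqr_ge0.
Qed.

(** Multiplying [x] by the conjugate of z = <x, y> turns the inner product into |z|^2, so the real
    inequality applies and a factor |z| cancels. *)
Lemma dot_cauchy_schwarz x y : Normc.normc (dot x y) <= nr x * nr y.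
Proof.
have [->|] := eqVneq (dot x y) 0; first by rewrite Normc.normc0 mulr_ge0 ?nr_ge0.
set z := dot x y => z0.
have n0 : 0 < Normc.normc z.
  rewrite lt_def; apply/andP; split; first by apply: contra z0 => /eqP/Normc.eq0_normc ->.
  by case: (z) => a b /=; rewrite sqrtr_ge0.
rewrite -(ler_pM2l n0).
have := cauchy_schwarz (z^*%C *: x) y.
rewrite nrZ {1}/rdot linearZl_LR /= -/z.
have -> : Normc.normc z^*%C = Normc.normc z by case: (z) => a b /=; rewrite sqrrN.
have -> : complex.Re (z^*%C * z) = Normc.normc z * Normc.normc z.
  case: (z) => a b; rewrite -expr2 /= sqr_sqrtr ?addr_ge0 ?sqr_ge0//.
  by rewrite mulNr opprK !expr2.
by rewrite -mulrA ger0_norm// mulr_ge0// ltW.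
Qed.

(** Cauchy-Schwarz for the form of [P] at [x] and [P x] gives |Px|^4 <= <Px, x> C |Px|^2. Thus a
    small value of the form forces a small image. *)
Lemma psd_sqr_nr_le P (C : R) x : linear P -> selfadj P ->
  (forall h, 0 <= rdot (P h) h) -> (forall h, rdot (P h) h <= C * nr h ^+ 2) ->
  nr (P x) ^+ 2 <= C * rdot (P x) x.
Proof.
move=> lP sP P0 PC.
have := psd_cauchy_schwarz P x (P x) lP sP P0.
rewrite rdot_nr => h1.
have h2 := PC (P x).
have [e|n0] := eqVneq (nr (P x)) 0.
  by rewrite (nr0_eq0 _ e) /rdot linear0l /= mulr0 nr0 expr0n.
rewrite -(@ler_pM2r _ (nr (P x) ^+ 2)) ?exprn_gt0 ?lt_def ?n0 ?nr_ge0//.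
have := P0 x; nra.
Qed.

Lemma bounded_opE T : bounded_op T ->
  linear T /\ exists2 M : R, 0 <= M & forall x, nr (T x) <= M * nr x.
Proof.
case=> lT [M hM]; split => //; exists `|M| => // x.
have := hM x; rewrite !nrE -rmorphM lecR => /le_trans; apply.
by rewrite ler_wpM2r ?nr_ge0 ?ler_norm.
Qed.

Lemma bounded_opI T (M : R) : linear T -> (forall x, nr (T x) <= M * nr x) -> bounded_op T.
Proof.
by move=> lT hM; split => //; exists M => x; rewrite !nrE -rmorphM lecR.
Qed.

Lemma rdot_bounded_le T (M : R) x : (forall x, nr (T x) <= M * nr x) ->
  `|rdot (T x) x| <= M * nr x ^+ 2.
Proof.
move=> hM; apply: (le_trans (cauchy_schwarz _ _)).
by rewrite expr2 mulrA ler_wpM2r ?nr_ge0.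
Qed.

Lemma dot_inj x y : (forall h, dot h x = dot h y) -> x = y.
Proof.
move=> e; apply/eqP; rewrite -subr_eq0; apply/eqP/nr0_eq0/eqP.
by rewrite -sqrf_eq0 -rdot_nr /rdot linearBr/= e subrr.
Qed.

(** The second hypothesis compares imaginary parts, since Re <x, i y> = Im <x, y>. *)
Lemma dot_rdot x y x' y' : rdot x y = rdot x' y' ->
  rdot x ('i *: y) = rdot x' ('i *: y') -> dot x y = dot x' y'.
Proof.
rewrite /rdot !linearZr_LR/=.
case: (dot x y) => a b; case: (dot x' y') => c d /= -> .
rewrite !mul0r !mulN1r !sub0r !opprK.
by move=> ->.
Qed.

(** * Completeness, Riesz representation and adjoints *)

Lemma invS_eventually_le (e : R) : 0 < e -> exists N, forall n, (N <= n)%N -> n.+1%:R^-1 <= e.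
Proof.
move=> e0; have [N _ hN] := near_infty_natSinv_lt (PosNum e0).
by exists N => n /hN /ltW.
Qed.

Lemma nr_cauchy_lim (u : nat -> H) :
  (forall e : R, 0 < e -> exists N, forall m n, (N <= m)%N -> (N <= n)%N ->
     nr (u m - u n) <= e) ->
  exists l, forall e : R, 0 < e -> exists N, forall n, (N <= n)%N -> nr (u n - l) <= e.
Proof.
move=> hu.
have : cvg (u @ \oo)%classic.
  apply/cauchy_cvgP/cauchy_ballP => e e0.
  have eE : e = (complex.Re e)%:C.
    by move: e0; case: (e) => a b; rewrite ltcE /= => /andP[/eqP -> _].
  have re0 : 0 < complex.Re e by move: e0; rewrite eE ltcR.
  have [N hN] := hu _ (divr_gt0 re0 (ltr0Sn _ 1)).
  pose U := [set x | exists2 n, (N <= n)%N & x = u n]%classic.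
  exists (U, U).
    by split; exists N => // n /= Nn; exists n.
  move=> [x y] /= [[m Nm ->] [n Nn ->]].
  rewrite -ball_normE /= nrE eE ltcR (le_lt_trans (hN _ _ Nm Nn))//.
  by rewrite ltr_pdivrMr// ltr_pMr// ltr1n.
move=> /cvg_ex [l /cvgrPdist_le hl]; exists l => e e0.
have e0' : 0 < e%:C by rewrite ltcR.
have [N _ hN] := hl _ e0'.
by exists N => n /hN; rewrite nrE lecR nrBC.
Qed.

(* Minimises [<Px, x> - 2 phi x]; the case [P = id] is the Riesz representation
   theorem for real-linear functionals. *)
Lemma coercive_riesz P (phi : H -> R) (c M K : R) :
  linear P -> selfadj P -> 0 < c -> (forall x, c * nr x ^+ 2 <= rdot (P x) x) ->
  (forall x, nr (P x) <= M * nr x) ->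
  {morph phi : x y / x + y} -> (forall t x, phi (t%:C *: x) = t * phi x) ->
  (forall x, `|phi x| <= K * nr x) ->
  exists z, forall h, rdot (P z) h = phi h.
Proof.
move=> lP sP c0 cP PM phiD phiZ phiK.
pose J x := rdot (P x) x - 2 * phi x.
(* Completing the square in c s^2 - 2 K s, with s = [nr x], gives this lower bound. *)
have JK x : - K ^+ 2 / c <= J x.
  have h1 := cP x; have /ler_normlP[_ h2] := phiK x.
  apply: (@le_trans _ _ (c * nr x ^+ 2 - 2 * (K * nr x))); last by rewrite /J; lra.
  rewrite ler_pdivrMr//.
  have := sqr_ge0 (c * nr x - K); rewrite !expr2; lra.
pose m := inf (range J)%classic.
have hJ : has_inf (range J)%classic.
  split; first by exists (J 0), 0.
  by exists (- K ^+ 2 / c) => _ [x _ <-].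
have mJ x : m <= J x by apply: ge_inf; [exact: hJ.2 | exists x].
have /choice[u hu] n : exists x, J x < m + n.+1%:R^-1.
  have n0 : 0 < n.+1%:R^-1 :> R by rewrite invr_gt0.
  have [_ [x _ <-] hx] := inf_adherent n0 hJ.
  by exists x.
have Jquad x h t : J (x + t%:C *: h)
    = J x + 2 * t * (rdot (P x) h - phi h) + t ^+ 2 * rdot (P h) h.
  rewrite /J (linD _ lP) (linZ _ _ lP) phiD phiZ !(rdotDl, rdotDr, rdotZl, rdotZr).
  by rewrite (selfadjr _ h x sP) (rdotC h); ring.
(* Parallelogram law at the midpoint of [x] and [y], where [J] is at least [m]; it makes minimising
   sequences Cauchy. *)
have Jpar x y : c * nr (x - y) ^+ 2 <= 2 * J x + 2 * J y - 4 * m.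
  apply: (le_trans (cP _)).
  have e1 := Jquad y (x - y) 1; have e2 := Jquad y (x - y) (2^-1).
  have := mJ (y + (2^-1)%:C *: (x - y)); rewrite e2.
  move: e1; rewrite scale1r (addrC x) addNKr => ->.
  lra.
have [z hz] : exists l, forall e : R, 0 < e -> exists N, forall n, (N <= n)%N -> nr (u n - l) <= e.
  apply: nr_cauchy_lim => e e0.
  have [N hN] := invS_eventually_le (c * e ^+ 2 / 4) (divr_gt0 (mulr_gt0 c0 (exprn_gt0 2 e0)) (ltr0Sn _ 3)).
  exists N => i j Ni Nj.
  apply: sqr_le; first exact: ltW.
  rewrite -(ler_pM2l c0).
  apply: (le_trans (Jpar _ _)).
  move: (hN _ Ni) (hN _ Nj) (hu i) (hu j).
  by move: i.+1%:R^-1 j.+1%:R^-1 (J _) (J _) (c * e ^+ 2) => *; lra.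
exists z => h; apply/eqP; rewrite -subr_eq0 -normr_le0; apply/ler_addgt0Pr => e e0; rewrite add0r.
set D := rdot (P z) h - phi h.
have a0 : 0 <= rdot (P h) h by apply: le_trans (cP h); rewrite mulr_ge0 ?sqr_ge0 ?ltW.
have [N1 hN1] := invS_eventually_le ((e / 2) ^+ 2 / (rdot (P h) h + 1))
  (divr_gt0 (exprn_gt0 2 (divr_gt0 e0 (ltr0Sn _ 1))) (ltr_wpDl a0 ltr01)).
have MK0 : 0 < `|M| * nr h + 1 by rewrite ltr_wpDl// mulr_ge0 ?nr_ge0.
have [N2 hN2] := hz (e / 2 / (`|M| * nr h + 1)) (divr_gt0 (divr_gt0 e0 (ltr0Sn _ 1)) MK0).
pose n := maxn N1 N2.
set w := u n.
pose Dn := rdot (P w) h - phi h.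
(* Since [J] at w + t h is at least [m], hence above J w - 1/(n+1), a quadratic in t is
   non-negative, and its discriminant bounds Dn^2 by <Ph, h>/(n+1). *)
have h1 : `|Dn| <= e / 2.
  apply: sqr_le_norm; first by rewrite divr_ge0 ?ltW.
  apply: (@le_trans _ _ (rdot (P h) h * n.+1%:R^-1)).
    apply: quad_ge0_discr => // t.
    have := mJ (w + t%:C *: h); rewrite Jquad -/Dn.
    by have := hu n; rewrite -/w; move: n.+1%:R^-1 => *; lra.
  have := hN1 n (leq_maxl _ _).
  rewrite ler_pdivlMr ?ltr_wpDl// => h1.
  apply: le_trans h1; rewrite mulrC ler_wpM2l ?invr_ge0//; lra.
have h2 : `|Dn - D| <= e / 2.
  have -> : Dn - D = rdot (P (w - z)) h by rewrite (linB _ lP) rdotBl /Dn /D; ring.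
  apply: (le_trans (cauchy_schwarz _ _)).
  have h3 : nr (P (w - z)) <= `|M| * nr (w - z).
    by apply: (le_trans (PM _)); rewrite ler_wpM2r ?nr_ge0 ?ler_norm.
  have := hN2 n (leq_maxr _ _); rewrite -/w ler_pdivlMr// => h4.
  have := nr_ge0 h; have := nr_ge0 (w - z).
  have := normr_ge0 M; nra.
move: h1 h2; rewrite !ler_norml => /andP[? ?] /andP[? ?]; apply/andP; split; lra.
Qed.

(** Lax-Milgram for self-adjoint [P]: surjectivity is [coercive_riesz] applied to the functional
    [rdot y], and coercivity makes [P] injective with inverse of norm at most 1/c. *)
Lemma coercive_inv P (c M : R) : linear P -> selfadj P -> 0 < c ->
  (forall x, c * nr x ^+ 2 <= rdot (P x) x) ->
  (forall x, nr (P x) <= M * nr x) ->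
  exists2 S, bounded_op S & cancel P S /\ cancel S P.
Proof.
move=> lP sP c0 cP PM.
have lb x : c * nr x <= nr (P x).
  have := nr_ge0 x; rewrite le_eqVlt => /predU1P[<-|x0]; first by rewrite mulr0 nr_ge0.
  rewrite -(ler_pM2r x0) -mulrA -expr2 (le_trans (cP x))//.
  by rewrite (le_trans (ler_norm _))// cauchy_schwarz.
have injP : injective P.
  move=> x y e; apply/eqP; rewrite -subr_eq0; apply/eqP/nr0_eq0/le_anti.
  rewrite nr_ge0 andbT -(ler_pM2l c0) mulr0 (le_trans (lb _))//.
  by rewrite (linB _ lP) e subrr nr0.
have /choice[S hS] y : exists x, P x = y.
  have [z hz] := coercive_riesz P (rdot y) c M (nr y) lP sP c0 cP PM
    (fun a b => rdotDr a b y) (fun t a => rdotZr t y a) (fun a => cauchy_schwarz y a).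
  exists z; apply: dot_inj => h; rewrite dotC [RHS]dotC.
  by congr (_^*%C); apply: dot_rdot; exact: hz.
exists S; last by split => // x; apply: injP.
apply: (bounded_opI _ c^-1) => [a x y|x].
  by apply: injP; rewrite hS lP !hS.
by rewrite -(ler_pM2l c0) mulrA divff ?gt_eqF// mul1r -{2}(hS x).
Qed.

(** For fixed [y], the Riesz vector of x |-> Re <Tx, y> is the value of the adjoint at [y]; testing
    at i x as well recovers the imaginary part. *)
Lemma adjoint_exists T : bounded_op T -> exists S, is_adjoint dot T S.
Proof.
move=> /bounded_opE [lT [M M0 TM]].
have /choice[S hS] y : exists z, forall x, dot (T x) y = dot x z.
  have [] := @coercive_riesz id (fun x => rdot (T x) y) 1 1 (M * nr y) => //.
  - by move=> x; rewrite mul1r rdot_nr.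
  - by move=> x; rewrite mul1r.
  - by move=> a b; rewrite (linD _ lT) rdotDl.
  - by move=> t a; rewrite (linZ _ _ lT) rdotZl.
  - move=> a; rewrite (le_trans (cauchy_schwarz _ _))// mulrAC ler_wpM2r ?nr_ge0//.
  move=> z hz; exists z => x.
  rewrite dotC [RHS]dotC; congr (_^*%C).
  apply: dot_rdot; first by rewrite rdotC -hz rdotC.
  have := hz ('i *: x); rewrite (linZ _ _ lT) => e.
  by rewrite rdotC -e rdotC.
exists S; split => //; apply: (bounded_opI _ M) => [a x y|y].
  by apply: dot_inj => h; rewrite -hS !linearPr /= !hS.
have := nr_ge0 (S y); rewrite le_eqVlt => /predU1P[<-|x0]; first by rewrite mulr_ge0 ?nr_ge0.
rewrite -(ler_pM2l x0) -expr2 -rdot_nr {1}/rdot -hS.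
rewrite (le_trans (ler_norm _))// (le_trans (cauchy_schwarz _ _))//.
by rewrite mulrA [nr _ * M]mulrC ler_wpM2r ?nr_ge0.
Qed.

Lemma adjointP T : bounded_op T -> is_adjoint dot T (adjoint dot T).
Proof. by move=> /adjoint_exists[S hS]; rewrite /adjoint; case: xgetP => [?|/(_ S)]. Qed.

(** * Polynomials of an operator *)

Implicit Types (p q : {poly R[i]}).

(** Complex coefficients, unlike those of [poly_op], allow a polynomial of [T] to be split into
    linear factors. *)
Definition cpoly_op (p : {poly R[i]}) T : H -> H :=
  fun x => \sum_(i < size p) p`_i *: iter i T x.

Lemma cpoly_opE n p T x : (size p <= n)%N -> cpoly_op p T x = \sum_(i < n) p`_i *: iter i T x.
Proof.
move=> pn; rewrite /cpoly_op (big_ord_widen n (fun i => p`_i *: iter i T x) pn) big_mkcond.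
apply: eq_bigr => i _; case: ltnP => // pi.
by rewrite nth_default// scale0r.
Qed.

Lemma cpoly_opD p q T x : cpoly_op (p + q) T x = cpoly_op p T x + cpoly_op q T x.
Proof.
set n := maxn (size p) (size q).
rewrite !(cpoly_opE n) ?leq_maxl ?leq_maxr ?size_polyD//.
by rewrite -big_split; apply: eq_bigr => i _; rewrite coefD scalerDl.
Qed.

Lemma cpoly_opZ k p T x : cpoly_op (k *: p) T x = k *: cpoly_op p T x.
Proof.
rewrite !(cpoly_opE (size p)) ?size_scale_leq// scaler_sumr.
by apply: eq_bigr => i _; rewrite coefZ scalerA.
Qed.

Lemma cpoly_opC k T x : cpoly_op k%:P T x = k *: x.
Proof. by rewrite (cpoly_opE 1) ?size_polyC_leq1// big_ord1 coefC. Qed.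

Lemma cpoly_opMX p T x : cpoly_op (p * 'X) T x = cpoly_op p T (T x).
Proof.
have [->|p0] := eqVneq p 0; first by rewrite mul0r -(polyC0 R[i]) !cpoly_opC !scale0r.
rewrite (cpoly_opE (size p).+1) ?size_mulX// big_ord_recl coefMX/= scale0r add0r.
by apply: eq_bigr => i _; rewrite coefMX/= -iterS iterSr.
Qed.

Lemma cpoly_opMXC p k T x : cpoly_op (p * 'X + k%:P) T x = cpoly_op p T (T x) + k *: x.
Proof. by rewrite cpoly_opD cpoly_opMX cpoly_opC. Qed.

Lemma cpoly_opXsub k T x : cpoly_op ('X - k%:P) T x = T x - k *: x.
Proof. by rewrite -polyCN -['X]mul1r cpoly_opMXC cpoly_opC scale1r scaleNr. Qed.

Lemma cpoly_op_comm p T x : linear T -> cpoly_op p T (T x) = T (cpoly_op p T x).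
Proof.
move=> lT; elim/poly_ind: p x => [|p k IH] x.
  by rewrite -(polyC0 R[i]) !cpoly_opC !scale0r (lin0 _ lT).
by rewrite !cpoly_opMXC IH (linD _ lT) (linZ _ _ lT).
Qed.

Lemma cpoly_opM p q T x : linear T -> cpoly_op (p * q) T x = cpoly_op p T (cpoly_op q T x).
Proof.
move=> lT; elim/poly_ind: p x => [|p k IH] x.
  by rewrite mul0r -(polyC0 R[i]) !cpoly_opC !scale0r.
by rewrite mulrDl mulrAC cpoly_opD cpoly_opMX mul_polyC cpoly_opZ cpoly_opMXC IH cpoly_op_comm.
Qed.

Lemma cpoly_op_linear p T : linear T -> linear (cpoly_op p T).
Proof.
move=> lT; elim/poly_ind: p => [|p k IH] a x y.
  by rewrite -(polyC0 R[i]) !cpoly_opC !scale0r scaler0 add0r.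
by rewrite !cpoly_opMXC lT IH !scalerDr !scalerA (mulrC k) addrACA.
Qed.

Lemma cpoly_op_bound p T (M : R) : 0 <= M -> (forall x, nr (T x) <= M * nr x) ->
  exists2 K : R, 0 <= K & forall x, nr (cpoly_op p T x) <= K * nr x.
Proof.
move=> M0 TM; elim/poly_ind: p => [|p k [K K0 hK]].
  by exists 0 => // x; rewrite -(polyC0 R[i]) cpoly_opC scale0r nr0 mul0r.
have k0 : 0 <= Normc.normc k by case: k => a b; rewrite sqrtr_ge0.
exists (K * M + Normc.normc k) => [|x]; first by rewrite addr_ge0 ?mulr_ge0.
rewrite cpoly_opMXC (le_trans (nrD _ _))// nrZ mulrDl lerD2r.
by rewrite (le_trans (hK _))// -mulrA ler_wpM2l.
Qed.

Lemma poly_op_cpoly_op (p : {poly R}) T x :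
  poly_op p T x = cpoly_op (map_poly (real_complex R) p) T x.
Proof.
rewrite /poly_op /cpoly_op size_map_poly; apply: eq_bigr => i _.
by rewrite coef_map.
Qed.

Lemma poly_opD (p q : {poly R}) T x : poly_op (p + q) T x = poly_op p T x + poly_op q T x.
Proof. by rewrite !poly_op_cpoly_op rmorphD cpoly_opD. Qed.

Lemma poly_opC t T x : poly_op t%:P T x = t%:C *: x.
Proof. by rewrite poly_op_cpoly_op map_polyC cpoly_opC. Qed.

Lemma poly_opM (p q : {poly R}) T x : linear T ->
  poly_op (p * q) T x = poly_op p T (poly_op q T x).
Proof. by move=> lT; rewrite !poly_op_cpoly_op rmorphM cpoly_opM. Qed.

Lemma poly_opN (p : {poly R}) T x : poly_op (- p) T x = - poly_op p T x.
Proof. by rewrite !poly_op_cpoly_op rmorphN -scaleN1r cpoly_opZ scaleN1r. Qed.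

Lemma poly_opB (p q : {poly R}) T x : poly_op (p - q) T x = poly_op p T x - poly_op q T x.
Proof. by rewrite poly_opD poly_opN. Qed.

Lemma poly_opX T x : poly_op 'X T x = T x.
Proof. by rewrite poly_op_cpoly_op map_polyX -['X]mul1r cpoly_opMX cpoly_opC scale1r. Qed.

Lemma poly_opXsub t T x : poly_op ('X - t%:P) T x = T x - t%:C *: x.
Proof. by rewrite poly_opB poly_opX poly_opC. Qed.

Lemma poly_op_linear (p : {poly R}) T : linear T -> linear (poly_op p T).
Proof.
move=> lT k x y; rewrite !poly_op_cpoly_op; exact: cpoly_op_linear.
Qed.

Lemma poly_op_bound (p : {poly R}) T : bounded_op T ->
  exists2 K : R, 0 <= K & forall x, nr (poly_op p T x) <= K * nr x.
Proof.
move=> /bounded_opE[_ [M M0 TM]]; have [K K0 hK] := cpoly_op_bound (map_poly (real_complex R) p) T M M0 TM.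
by exists K => // x; rewrite poly_op_cpoly_op.
Qed.

Lemma dotZRr t x y : dot x (t%:C *: y) = t%:C * dot x y.
Proof. by rewrite linearZr_LR/=; congr (_ * _); exact: conjc_real. Qed.

Lemma poly_op_selfadj (p : {poly R}) T : linear T -> selfadj T -> selfadj (poly_op p T).
Proof.
move=> lT sT; elim/poly_ind: p => [|p t IH] x y.
  by rewrite -(polyC0 R) !poly_opC !scale0r linear0l linear0r.
rewrite !poly_opD !poly_opM// !poly_opX !poly_opC linearDl linearDr/= IH sT.
by rewrite dotZRr linearZl_LR !poly_op_cpoly_op cpoly_op_comm.
Qed.

(** * Spectral positivity *)

(** Its failure for T - k says that [k] is in the approximate point spectrum of [T]. *)
Definition bounded_below T := exists2 c : R, 0 < c & forall x, c * nr x <= nr (T x).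

Lemma bounded_below_prod T (rs : seq R[i]) : linear T ->
  (forall k, k \in rs -> bounded_below (fun x => T x - k *: x)) ->
  bounded_below (cpoly_op (\prod_(k <- rs) ('X - k%:P)) T).
Proof.
move=> lT; elim: rs => [|k rs IH] hrs.
  by exists 1 => // x; rewrite big_nil cpoly_opC scale1r mul1r.
have [c c0 hc] := hrs k (mem_head _ _).
have [l hl|d d0 hd] := IH; first by apply: hrs; rewrite inE hl orbT.
exists (c * d) => [|x]; first exact: mulr_gt0.
rewrite big_cons cpoly_opM// cpoly_opXsub.
by rewrite (le_trans _ (hc _))// -mulrA ler_pM2l.
Qed.

(** As <Tx, x> is real, <(T - k) x, x> has imaginary part -(Im k) |x|^2, and Cauchy-Schwarz bounds
    its modulus by |(T - k) x| |x|. *)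
Lemma bounded_below_nonreal T k : selfadj T -> complex.Im k != 0 ->
  bounded_below (fun x => T x - k *: x).
Proof.
move=> sT k0; exists `|complex.Im k| => [|x]; first by rewrite normr_gt0.
have := nr_ge0 x; rewrite le_eqVlt => /predU1P[<-|x0]; first by rewrite mulr0 nr_ge0.
rewrite -(ler_pM2r x0) (le_trans _ (dot_cauchy_schwarz _ _))//.
have : dot (T x) x = (dot (T x) x)^*%C by rewrite -dotC sT.
have -> : dot (T x - k *: x) x = dot (T x) x - k * dot x x.
  by rewrite linearBl/= linearZl_LR.
rewrite dotE nrE -rmorphXn.
case: (dot (T x) x) => a b [bN]; case: k k0 => c d /= _.
have -> : b = 0 by lra.
have -> : `|d| * nr x * nr x = Num.sqrt ((0 - (c * 0 + d * nr x ^+ 2)) ^+ 2).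
  by rewrite sqrtr_sqr mulr0 !add0r normrN normrM normrX (ger0_norm (nr_ge0 x)) expr2 mulrA.
by rewrite ler_wsqrtr// lerDr sqr_ge0.
Qed.

(** Up to the leading coefficient, p(T) is a product of factors T - k over the complex roots of [p].
    One of them fails to be bounded below, and its [k] is real by [bounded_below_nonreal]. *)
Lemma root_not_bounded_below T (p : {poly R}) : linear T -> selfadj T -> p != 0 ->
  ~ bounded_below (poly_op p T) ->
  exists2 t, root p t & ~ bounded_below (fun x => T x - t%:C *: x).
Proof.
move=> lT sT p0 np.
pose P := map_poly (real_complex R) p.
have P0 : lead_coef P != 0 by rewrite lead_coef_eq0 map_poly_eq0.
have [rs Prs] := closed_field_poly_normal P.
have [k kP nk] : exists2 k, k \in rs & ~ bounded_below (fun x => T x - k *: x).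
  apply: contrapT => /forall2NP hrs; apply: np.
  have [k kr|c c0 hc] := bounded_below_prod T rs lT.
    by have [] := hrs k => // /contrapT.
  have n0 : 0 < Normc.normc (lead_coef P) by rewrite -ltcR (normr_gt0 (lead_coef P)).
  exists (Normc.normc (lead_coef P) * c) => [|x]; first exact: mulr_gt0.
  by rewrite poly_op_cpoly_op -/P [in leRHS]Prs cpoly_opZ nrZ -mulrA ler_pM2l.
have kE : k = (complex.Re k)%:C.
  have [|] := eqVneq (complex.Im k) 0; first by case: (k) => a b /= ->.
  by move=> /(bounded_below_nonreal T k sT).
exists (complex.Re k); last by rewrite -kE.
have : root P (complex.Re k)%:C by rewrite -kE Prs rootZ// root_prod_XsubC.
by rewrite fmorph_root.
Qed.

Lemma not_bounded_below_spectrum T k : ~ bounded_below (fun x => T x - k *: x) -> spectrum T k.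
Proof.
move=> nb [S /bounded_opE[_ [M M0 SM]] [KS _]]; apply: nb.
exists (M + 1)^-1 => [|x]; first by rewrite invr_gt0 ltr_wpDl.
rewrite mulrC ler_pdivrMr ?ltr_wpDl// -{1}(KS x) (le_trans (SM _))//.
by rewrite mulrC ler_wpM2l ?nr_ge0// lerDl.
Qed.

(** Let [m] be the infimum of the form on the unit sphere, so that T - m is positive. At
    near-minimisers its form is small, hence so is its image by [psd_sqr_nr_le]. The vector [x0]
    makes the sphere nonempty. *)
Lemma inf_not_bounded_below T x0 : bounded_op T -> selfadj T -> x0 != 0 ->
  exists2 m : R, m * nr x0 ^+ 2 <= rdot (T x0) x0 &
    ~ bounded_below (fun x => T x - m%:C *: x).
Proof.
move=> bT sT x00; have [lT [M M0 TM]] := bounded_opE _ bT.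
pose E := [set rdot (T x) x | x in [set x | nr x = 1]]%classic.
have unitE x : x != 0 -> exists2 y, E (rdot (T y) y) & x = (nr x)%:C *: y.
  move=> xn0; have n0 : nr x != 0 by apply: contra xn0 => /eqP/nr0_eq0 ->.
  exists ((nr x)^-1%:C *: x); last by rewrite scalerA -rmorphM divff// scale1r.
  by exists ((nr x)^-1%:C *: x); rewrite //= nrZR normfV ger0_norm ?nr_ge0// mulVf.
have hE : has_inf E.
  split; first by have [y Ey _] := unitE _ x00; eexists; exact: Ey.
  exists (- M) => _ [x /= x1 <-].
  by have := rdot_bounded_le T M x TM; rewrite x1 expr1n mulr1 ler_norml => /andP[].
pose m := inf E.
have mT x : m * nr x ^+ 2 <= rdot (T x) x.
  have [->|/unitE[y Ey xy]] := eqVneq x 0.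
    by rewrite (lin0 _ lT) nr0 expr0n mulr0 rdot_nr nr0 expr0n.
  rewrite {2 3}xy rdotZZ// mulrC ler_wpM2l ?sqr_ge0//.
  by apply: ge_inf Ey; exact: hE.2.
exists m => // -[c c0 hc].
pose N := poly_op ('X - m%:P) T.
have NE x : rdot (N x) x = rdot (T x) x - m * nr x ^+ 2.
  by rewrite /N poly_opXsub rdotBl rdotZl rdot_nr.
pose C := M + `|m|.
have C0 : 0 < C + 1 by rewrite ltr_wpDl// addr_ge0.
(* With this margin C <Nx, x> < c^2 for a near-minimiser [x], whereas the lower bound [c] would
   force c^2 <= |Nx|^2 <= C <Nx, x>. *)
have d0 : 0 < c ^+ 2 / (C + 1) by rewrite divr_gt0// exprn_gt0.
have [_ [x /= x1 <-]] := inf_adherent d0 hE; rewrite -/m => hx.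
have NC : nr (N x) ^+ 2 <= C * rdot (N x) x.
  apply: psd_sqr_nr_le => [||h|h].
  - exact: poly_op_linear.
  - exact: poly_op_selfadj.
  - by rewrite NE subr_ge0.
  - rewrite NE /C mulrDl lerD//.
      by rewrite (le_trans (ler_norm _))// rdot_bounded_le.
    by rewrite -mulNr ler_wpM2r ?sqr_ge0// -normrN ler_norm.
have := hc x; rewrite -poly_opXsub -/N x1 mulr1 => cN.
have : c ^+ 2 <= nr (N x) ^+ 2 by rewrite ler_pXn2r ?nnegrE ?nr_ge0// ltW.
rewrite NE x1 expr1n mulr1 in NC.
have := mT x; rewrite x1 expr1n mulr1.
move: hx; rewrite -ltrBlDl ltr_pdivlMr// mulrDr mulr1 (mulrC _ C).
by move: (C * _) NC => D; lra.
Qed.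

Lemma spectral_pos T (q : {poly R}) : bounded_op T -> selfadj T ->
  (forall t, spectrum T t%:C -> 0 <= q.[t]) ->
  forall x, 0 <= rdot (poly_op q T x) x.
Proof.
move=> bT sT q0 x; rewrite leNgt; apply/negP => qx.
have [lT _] := bounded_opE _ bT.
have x0 : x != 0.
  by apply: contraTneq qx => ->; rewrite rdotC /rdot linear0l ltxx.
have bq : bounded_op (poly_op q T).
  have [K _ hK] := poly_op_bound q T bT.
  by apply: bounded_opI hK; exact: poly_op_linear.
have [m mq nm] := inf_not_bounded_below _ _ bq (poly_op_selfadj q _ lT sT) x0.
have m0 : m < 0.
  rewrite ltNge; apply/negP => m0.
  by have := le_lt_trans mq qx; rewrite ltNge mulr_ge0 ?sqr_ge0.
(* If [q] is the constant [m], the contradiction is that the spectrum is nonempty. *)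
have [qm|qm] := eqVneq (q - m%:P) 0.
  have [m' _ /not_bounded_below_spectrum /q0] := inf_not_bounded_below _ _ bT sT x0.
  by move/eqP: qm; rewrite subr_eq0 => /eqP ->; rewrite hornerC leNgt m0.
have [|t] := root_not_bounded_below T (q - m%:P) lT sT qm.
  by move=> h; apply: nm; case: h => c c0 hc; exists c => // y; rewrite -(poly_opC _ T) -poly_opB.
rewrite rootE !hornerE subr_eq0 => /eqP qt /not_bounded_below_spectrum /q0.
by rewrite qt leNgt m0.
Qed.

Lemma spectral_bound T (q : {poly R}) (c : R) : bounded_op T -> selfadj T ->
  0 <= c -> (forall t, spectrum T t%:C -> `|q.[t]| <= c) ->
  forall x, nr (poly_op q T x) <= c * nr x.
Proof.
move=> bT sT c0 qc x; have [lT _] := bounded_opE _ bT.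
apply: sqr_le; first by rewrite mulr_ge0 ?nr_ge0.
have h := spectral_pos T ((c ^+ 2)%:P - q * q) bT sT.
rewrite -subr_ge0 exprMn -!rdot_nr -(selfadjr _ _ _ (poly_op_selfadj q T lT sT)).
rewrite -poly_opM// -rdotZl -rdotBl -(poly_opC _ T) -poly_opB; apply: h => t /qc qt.
rewrite !hornerE subr_ge0 -expr2 -real_normK ?num_real//.
by rewrite ler_pXn2r ?nnegrE.
Qed.

(** Outside [0, M] one of T - t and t - T is coercive, with constant -t or t - M respectively, hence
    invertible. *)
Lemma spectrum_itv T (M : R) t : bounded_op T -> selfadj T ->
  (forall x, 0 <= rdot (T x) x) -> (forall x, rdot (T x) x <= M * nr x ^+ 2) ->
  spectrum T t%:C -> 0 <= t <= M.
Proof.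
move=> bT sT T0 TM tT; have [lT _] := bounded_opE _ bT.
apply/andP; split; rewrite leNgt; apply/negP => ht; apply: tT.
  have [K K0 hK] := poly_op_bound ('X - t%:P) T bT.
  have [|||||S bS [S1 S2]] := coercive_inv (poly_op ('X - t%:P) T) (- t) K.
  - exact: poly_op_linear.
  - exact: poly_op_selfadj.
  - by rewrite oppr_gt0.
  - move=> x; rewrite poly_opXsub rdotBl rdotZl rdot_nr mulNr.
    by rewrite lerBrDl subrr.
  - exact: hK.
  - by exists S => //; split=> x; [rewrite -poly_opXsub S1|rewrite -poly_opXsub S2].
have [K K0 hK] := poly_op_bound (t%:P - 'X) T bT.
have [|||||S bS [S1 S2]] := coercive_inv (poly_op (t%:P - 'X) T) (t - M) K.
- exact: poly_op_linear.
- exact: poly_op_selfadj.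
- by rewrite subr_gt0.
- move=> x; rewrite poly_opB poly_opC poly_opX rdotBl rdotZl rdot_nr mulrBl.
  by rewrite lerD2l lerN2.
- exact: hK.
have [lS [L L0 SL]] := bounded_opE _ bS.
(* [S] inverts t - T, so the inverse of T - t is [S] after negation. *)
exists (fun x => S (- x)).
  apply: (bounded_opI _ L) => [a x y|x]; last by rewrite -(nrN x).
  by rewrite opprD -scalerN lS.
by split=> x; rewrite -poly_opXsub -(opprB t%:P 'X) poly_opN ?opprK ?S1// S2 opprK.
Qed.

(** * Continuous functional calculus *)

Definition psd_op T := forall x, 0 <= rdot (T x) x.

Lemma bounded_op_form_le T : bounded_op T ->
  exists2 M : R, 0 < M & forall x, rdot (T x) x <= M * nr x ^+ 2.
Proof.
move=> /bounded_opE[_ [M M0 TM]]; exists (M + 1) => [|x]; first by rewrite ltr_wpDl.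
rewrite (le_trans (ler_norm _))// (le_trans (rdot_bounded_le _ _ _ TM))//.
by rewrite ler_wpM2r ?sqr_ge0// lerDl.
Qed.

Lemma selfadj_rdot T : linear T -> (forall x y, rdot (T x) y = rdot x (T y)) -> selfadj T.
Proof.
move=> lT sT x y; apply: dot_rdot; first exact: sT.
by rewrite -(linZ _ _ lT).
Qed.

(** Polynomials within 1/(n+1) of [f] on [0, M], which contains the spectrum, have values at [T]
    that are Cauchy in norm by [spectral_bound]. Completeness gives a pointwise limit, and the
    Cauchy estimate makes the convergence uniform. *)
Lemma cfc_exists T (f : R -> R) (M : R) : bounded_op T -> selfadj T -> psd_op T ->
  (forall x, rdot (T x) x <= M * nr x ^+ 2) ->
  (forall e : R, 0 < e -> exists p : {poly R},
     forall t : R, 0 <= t <= M -> `|p.[t] - f t| <= e) ->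
  exists S, is_cfc f T S.
Proof.
move=> bT sT T0 TM fp; have [lT _] := bounded_opE _ bT.
pose d n : R := n.+1%:R^-1.
have d0 n : 0 < d n by rewrite invr_gt0.
have /choice[p hp] n := fp (d n) (d0 n).
have pf n t : spectrum T t%:C -> `|(p n).[t] - f t| <= d n.
  by move=> /(spectrum_itv T M t bT sT T0 TM); exact: hp.
have pp m n x : nr (poly_op (p m) T x - poly_op (p n) T x) <= (d m + d n) * nr x.
  rewrite -poly_opB; apply: spectral_bound => // [|t tT].
    by rewrite addr_ge0 ?ltW.
  rewrite hornerD hornerN; have := pf m t tT; have := pf n t tT.
  rewrite !ler_norml => /andP[? ?] /andP[? ?]; apply/andP; split; lra.
have /choice[S hS] x : exists l, forall e : R, 0 < e -> exists N, forall n, (N <= n)%N ->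
    nr (poly_op (p n) T x - l) <= e.
  apply: nr_cauchy_lim => e e0.
  have x1 : 0 < 2 * (nr x + 1) by rewrite mulr_gt0// ltr_wpDl ?nr_ge0.
  have [N hN] := invS_eventually_le (e / (2 * (nr x + 1))) (divr_gt0 e0 x1).
  exists N => m n /hN hm /hN hn; apply: (le_trans (pp m n x)).
  apply: (@le_trans _ _ ((e / (2 * (nr x + 1)) + e / (2 * (nr x + 1))) * (nr x + 1))).
    by apply: ler_pM; rewrite ?nr_ge0 ?addr_ge0 ?lerD ?lerDl// ltW.
  suff -> : (e / (2 * (nr x + 1)) + e / (2 * (nr x + 1))) * (nr x + 1) = e by [].
  by field; rewrite gt_eqF// ltr_wpDl ?nr_ge0.
(* Letting the other index grow in [pp] gives the rate; the maximum with [n] keeps its error at most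
   [d n]. *)
have pS n x : nr (poly_op (p n) T x - S x) <= 2 * d n * nr x.
  apply/ler_addgt0Pr => e e0; have [N hN] := hS x e e0.
  have -> : poly_op (p n) T x - S x = (poly_op (p n) T x - poly_op (p (maxn N n)) T x)
      + (poly_op (p (maxn N n)) T x - S x) by rewrite addrA addrNK.
  rewrite (le_trans (nrD _ _))// lerD ?hN ?leq_maxl//.
  rewrite (le_trans (pp _ _ _))// ler_wpM2r ?nr_ge0// mulr_natl mulr2n lerD2l.
  by rewrite lef_pV2 ?posrE// ler_nat ltnS leq_maxr.
have lS : linear S.
  move=> a x y; apply/eqP; rewrite -subr_eq0; apply/eqP/nr0_eq0/le_anti.
  rewrite nr_ge0 andbT.
  apply: (@scaled_small_le0 _ _
    (2 * nr (a *: x + y) + 2 * Normc.normc a * nr x + 2 * nr y)) => e e0 _.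
  have [N /(_ _ (leqnn N)) hN] := invS_eventually_le e e0.
  have -> : S (a *: x + y) - (a *: S x + S y) =
     - (poly_op (p N) T (a *: x + y) - S (a *: x + y))
     + (a *: (poly_op (p N) T x - S x) + (poly_op (p N) T y - S y)).
    rewrite (poly_op_linear _ _ lT) scalerBr [in RHS]addrACA -opprD opprB addrA.
    by rewrite subrK.
  rewrite (le_trans (nrD _ _))// nrN (le_trans (lerD (lexx _) (nrD _ _)))// nrZ.
  have h1 := pS N (a *: x + y); have h2 := pS N x; have h3 := pS N y.
  have a0 : 0 <= Normc.normc a by case: (a) => ? ?; rewrite sqrtr_ge0.
  have := ler_wpM2l a0 h2.
  have := nr_ge0 (a *: x + y); have := nr_ge0 x; have := nr_ge0 y.
  have := ler_wpM2r (nr_ge0 (a *: x + y)) hN.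
  have := ler_wpM2r (mulr_ge0 a0 (nr_ge0 x)) hN.
  have := ler_wpM2r (nr_ge0 y) hN.
  by rewrite -/(d N); lra.
exists S; split.
  have [K K0 hK] := poly_op_bound (p 0%N) T bT.
  apply: (bounded_opI _ (K + 2 * d 0%N)) => // x.
  have -> : S x = poly_op (p 0%N) T x - (poly_op (p 0%N) T x - S x).
    by rewrite opprB addrC subrK.
  by rewrite (le_trans (nrD _ _))// nrN mulrDl lerD.
exists p.
  apply/uniform_cvg_natP => e e0; have [N hN] := invS_eventually_le e e0.
  by exists N => n /hN dn t /(pf n) h; apply: le_trans dn.
move=> e e0; have [N hN] := invS_eventually_le (e / 2) (divr_gt0 e0 (ltr0Sn _ 1)).
exists N => // n /= /hN dn x.
rewrite nrE nrE -rmorphM lecR (le_trans (pS n x))// ler_wpM2r ?nr_ge0//.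
by rewrite mulrC -ler_pdivlMr.
Qed.

(** Joins both convergences at one index. Self-adjointness, order and the norm of the square root
    are drawn from this form. *)
Lemma is_cfc_approx T (f : R -> R) S : is_cfc f T S ->
  forall e : R, 0 < e -> exists p : {poly R},
    (forall t, spectrum T t%:C -> `|p.[t] - f t| <= e) /\
    (forall x, nr (poly_op p T x - S x) <= e * nr x).
Proof.
move=> [_ [p /uniform_cvg_natP pf pS]] e e0.
have [N1 hN1] := pf e e0; have [N2 _ hN2] := pS e e0.
exists (p (maxn N1 N2)); split; first exact: hN1 (leq_maxl _ _).
move=> x; have := hN2 _ (leq_maxr N1 N2) x.
by rewrite !nrE -rmorphM lecR.
Qed.

Lemma is_cfc_selfadj T (f : R -> R) S : bounded_op T -> selfadj T ->
  is_cfc f T S -> selfadj S.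
Proof.
move=> bT sT cS; have [lT _] := bounded_opE _ bT; have [bS _] := cS.
apply: selfadj_rdot => [|x y]; first by have [] := bounded_opE _ bS.
apply/eqP; rewrite -subr_eq0 -normr_le0.
apply: (@scaled_small_le0 _ _ (2 * (nr x * nr y))) => e e0 _.
have [p [_ hp]] := is_cfc_approx _ _ _ cS e e0.
have -> : rdot (S x) y - rdot x (S y) =
    rdot x (poly_op p T y - S y) - rdot (poly_op p T x - S x) y.
  rewrite rdotBr rdotBl (selfadjr _ _ _ (poly_op_selfadj p T lT sT)); ring.
rewrite (le_trans (ler_normB _ _))//.
have h1 := cauchy_schwarz x (poly_op p T y - S y).
have h2 := cauchy_schwarz (poly_op p T x - S x) y.
have := ler_wpM2l (nr_ge0 x) (hp y); have := ler_wpM2r (nr_ge0 y) (hp x).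
lra.
Qed.

(** If |p - f| <= e on the spectrum, then p + e - g is non-negative there and [spectral_pos]
    applies; replacing p(T) by [S] costs a further e |x|^2. *)
Lemma is_cfc_ge T (f : R -> R) S (g : {poly R}) : bounded_op T -> selfadj T ->
  is_cfc f T S -> (forall t, spectrum T t%:C -> g.[t] <= f t) ->
  forall x, rdot (poly_op g T x) x <= rdot (S x) x.
Proof.
move=> bT sT cS gf x; rewrite -subr_le0.
apply: (@scaled_small_le0 _ _ (2 * nr x ^+ 2)) => e e0 _.
have [p [hp1 hp2]] := is_cfc_approx _ _ _ cS e e0.
have : 0 <= rdot (poly_op (p + e%:P - g) T x) x.
  apply: spectral_pos => // t tT; rewrite !hornerE.
  by have := gf t tT; have := hp1 t tT; rewrite ler_norml => /andP[? ?] ?; lra.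
rewrite poly_opB poly_opD poly_opC rdotBl rdotDl rdotZl rdot_nr.
have := le_trans (cauchy_schwarz (poly_op p T x - S x) x) (ler_wpM2r (nr_ge0 x) (hp2 x)).
rewrite rdotBl -mulrA -expr2 ler_norml => /andP[? ?] ?; lra.
Qed.

Lemma is_cfc_psd T (f : R -> R) S : bounded_op T -> selfadj T ->
  is_cfc f T S -> (forall t, 0 <= f t) -> psd_op S.
Proof.
move=> bT sT cS f0 x.
have := is_cfc_ge T f S 0 bT sT cS _ x.
rewrite -(polyC0 R) poly_opC scale0r {1}/rdot linear0l; apply => t _.
by rewrite hornerC.
Qed.

(** For [p] near the square root, |p(T) x|^2 = <p(T)^2 x, x>, and p^2 - t is small on the spectrum.
    The norm identity thus follows without composing [S] with itself. *)
Lemma is_cfc_sqrt_nr T S : bounded_op T -> selfadj T -> psd_op T ->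
  is_cfc (fun t => t `^ 2^-1) T S -> forall x, nr (S x) ^+ 2 = rdot (T x) x.
Proof.
move=> bT sT T0 cS x; have [lT _] := bounded_opE _ bT.
have [M M0 TM] := bounded_op_form_le T bT.
pose m := Num.sqrt M; have m0 : 0 <= m by rewrite sqrtr_ge0.
apply/eqP; rewrite -subr_eq0 -normr_le0.
apply: (@scaled_small_le0 _ _
  ((2 * m + 1) * nr x ^+ 2 + nr x * (2 * nr (S x) + nr x))) => e e0 e1.
have [p [hp1 hp2]] := is_cfc_approx _ _ _ cS e e0.
(* The factor comes from |p^2 - t| = |p - sqrt t| |p + sqrt t| <= e (2 sqrt M + e), with e <= 1. *)
have pT : `|nr (poly_op p T x) ^+ 2 - rdot (T x) x| <= e * (2 * m + 1) * nr x ^+ 2.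
  have h := spectral_bound T (p * p - 'X) (e * (2 * m + 1)) bT sT _ _ x.
  have -> : nr (poly_op p T x) ^+ 2 - rdot (T x) x = rdot (poly_op (p * p - 'X) T x) x.
    rewrite poly_opB poly_opM// poly_opX rdotBl -rdot_nr.
    by rewrite (selfadjr _ (poly_op p T x) x (poly_op_selfadj p T lT sT)).
  rewrite (le_trans (cauchy_schwarz _ _))// expr2 mulrA ler_wpM2r ?nr_ge0// h//.
    by rewrite mulr_ge0 ?addr_ge0 ?mulr_ge0// ltW.
  move=> t tT; have /andP[t0 tM] := spectrum_itv T M t bT sT T0 TM tT.
  have := hp1 t tT; rewrite powR12_sqrt// !hornerE => hq.
  have tE : t = Num.sqrt t ^+ 2 by rewrite sqr_sqrtr.
  rewrite [X in _ - X]tE -expr2 subr_sqr normrM.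
  apply: ler_pM => //.
  have tm : Num.sqrt t <= m by rewrite ler_wsqrtr.
  have := sqrtr_ge0 t; move: hq; rewrite !ler_norml => /andP[? ?] ?.
  by apply/andP; split; lra.
have dS : `|nr (poly_op p T x) ^+ 2 - nr (S x) ^+ 2| <= e * (nr x * (2 * nr (S x) + nr x)).
  have h1 := hp2 x.
  have h2 := nrD (poly_op p T x - S x) (S x); rewrite subrK in h2.
  have h3 := nrD (S x - poly_op p T x) (poly_op p T x); rewrite subrK nrBC in h3.
  rewrite subr_sqr normrM mulrA; apply: ler_pM => //.
    rewrite ler_norml; apply/andP; split; lra.
  rewrite ger0_norm ?addr_ge0 ?nr_ge0//.
  have : e * nr x <= nr x by rewrite ler_piMl ?nr_ge0.
  lra.
move: pT dS; rewrite !ler_norml => /andP[? ?] /andP[? ?]; apply/andP; split; lra.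
Qed.

Lemma op_powRP T (s : R) : bounded_op T -> selfadj T -> psd_op T -> s = 2^-1 \/ 1 <= s ->
  is_cfc (fun t => t `^ s) T (op_powR T s).
Proof.
move=> bT sT T0 hs; have [M M0 TM] := bounded_op_form_le T bT.
have [S hS] := cfc_exists T (fun t => t `^ s) M bT sT T0 TM (powR_approx R M s M0 hs).
by rewrite /op_powR /cfc; case: xgetP => [?|/(_ S)].
Qed.

(** The form of the adjoint of [T] composed with [T] is |Tx|^2, hence non-negative, and
    [is_cfc_sqrt_nr] converts it into the norm of the square root. *)
Lemma op_absP T : bounded_op T ->
  [/\ bounded_op (op_abs dot T), selfadj (op_abs dot T), psd_op (op_abs dot T) &
      forall x, nr (op_abs dot T x) = nr (T x)].
Proof.
move=> bT; have [bS TS] := adjointP T bT.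
set S := adjoint dot T in bS TS *.
have [lT [K K0 TK]] := bounded_opE _ bT; have [lS [L L0 SL]] := bounded_opE _ bS.
have STE x y : dot ((S \o T) x) y = dot (T x) (T y).
  by rewrite dotC /= -TS -dotC.
have bU : bounded_op (S \o T).
  apply: (bounded_opI _ (L * K)) => [a x y /=|x /=]; first by rewrite lT lS.
  by rewrite (le_trans (SL _))// -mulrA ler_wpM2l.
have sU : selfadj (S \o T) by move=> x y; rewrite STE dotC -STE -dotC.
have rU x : rdot ((S \o T) x) x = nr (T x) ^+ 2 by rewrite /rdot STE -rdot_nr.
have U0 : psd_op (S \o T) by move=> x; rewrite rU sqr_ge0.
have cA := op_powRP _ 2^-1 bU sU U0 (or_introl erefl).
split.
- by case: cA.
- exact: is_cfc_selfadj cA.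
- by apply: is_cfc_psd cA _ => // t; exact: powR_ge0.
- move=> x; apply/eqP; rewrite -(@eqrXn2 _ 2) ?nr_ge0//.
  by rewrite (is_cfc_sqrt_nr _ _ bU sU U0 cA) rU.
Qed.

(* McCarthy's inequality, from the tangent to [u |-> u `^ r] at [l]. *)
Lemma op_abs_powR_ge T (r : R) x : bounded_op T -> 1 <= r -> nr x = 1 ->
  nr (T x) `^ (2 * r) <= rdot (op_powR (op_abs dot T) (2 * r) x) x.
Proof.
move=> bT r1 x1; have [bA sA A0 nA] := op_absP T bT.
have [lA _] := bounded_opE _ bA.
have r2 : 1 <= 2 * r by lra.
have cS := op_powRP _ (2 * r) bA sA A0 (or_intror r2).
set l := nr (T x) ^+ 2; have l0 : 0 <= l by rewrite sqr_ge0.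
(* The tangent to u^r at [l], taken at u = t^2 because |T|^(2r) is a function of |T|. As [l] is
   <|T|^2 x, x> and [x] is a unit vector, the form of g(|T|) at [x] is exactly l^r. *)
pose g : {poly R} := (r * l `^ (r - 1)) *: ('X * 'X) - ((r - 1) * l `^ r)%:P.
have [M M0 AM] := bounded_op_form_le _ bA.
have := is_cfc_ge _ _ _ g bA sA cS _ x.
rewrite /g -mul_polyC poly_opB !poly_opM// poly_opX poly_opX !poly_opC rdotBl !rdotZl.
rewrite rdot_nr (selfadjr _ _ _ sA) rdot_nr nA x1 -/l expr1n mulr1.
have -> : r * l `^ (r - 1) * l - (r - 1) * l `^ r = l `^ r.
  by rewrite -mulrA (mulrC _ l) mulr_powRB1 ?(lt_le_trans ltr01)//; ring.
rewrite powRrM powR_mulrn ?nr_ge0// -/l; apply => t tA.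
have /andP[t0 _] := spectrum_itv _ _ _ bA sA A0 AM tA.
rewrite !hornerE powRrM powR_mulrn//.
apply: le_trans (powR_tangent R r (t ^+ 2) l r1 (sqr_ge0 t) l0).
by rewrite [in leRHS]expr2 mulrA lexx.
Qed.

Lemma op_abs_powR_bounded_selfadj T (r : R) : bounded_op T -> 1 <= r ->
  bounded_op (op_powR (op_abs dot T) (2 * r)) /\
  selfadj (op_powR (op_abs dot T) (2 * r)).
Proof.
move=> bT r1; have [bA sA A0 _] := op_absP T bT.
have cS : is_cfc (fun t => t `^ (2 * r)) (op_abs dot T) (op_powR (op_abs dot T) (2 * r)).
  by apply: op_powRP => //; right; lra.
by split; [case: cS|exact: is_cfc_selfadj cS].
Qed.

Lemma selfadj_dot_real T x : selfadj T -> dot (T x) x = (rdot (T x) x)%:C.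
Proof.
move=> sT; have : dot (T x) x = (dot (T x) x)^*%C by rewrite -dotC sT.
by rewrite /rdot; case: (dot (T x) x) => a b /= [bN]; congr Complex; lra.
Qed.

(** * Numerical radius *)

(** Boundedness of [T] supplies the upper bound without which [sup] would be a default value. *)
Lemma numerical_radius_ge T x : bounded_op T -> nr x = 1 ->
  Normc.normc (dot (T x) x) <= numerical_radius dot T.
Proof.
move=> /bounded_opE[_ [M M0 TM]] x1; apply: ub_le_sup.
  exists M => _ [y /= y1 <-].
  have ny : nr y = 1 by rewrite /nr y1.
  rewrite (le_trans (dot_cauchy_schwarz _ _))// ny mulr1.
  by have := TM y; rewrite ny mulr1.
by exists x => //=; rewrite nrE x1.
Qed.

(** For trivial [H] the set is empty and its [sup] is 0, whence the condition on [c]; the lower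
    bound allows powers to be compared. *)
Lemma numerical_radius_le T (c : R) : 0 <= c ->
  (forall x, nr x = 1 -> Normc.normc (dot (T x) x) <= c) ->
  0 <= numerical_radius dot T <= c.
Proof.
move=> c0 hc; rewrite /numerical_radius.
set E := [set _ | _ in _]%classic.
have Ec (y : R) : E y -> 0 <= y <= c.
  move=> [x /= x1 <-]; rewrite hc ?andbT; last by rewrite /nr x1.
  by case: (dot _ _) => a b; rewrite sqrtr_ge0.
have [->|/set0P E0] := eqVneq E set0; first by rewrite sup0 lexx.
apply/andP; split; last by apply: ge_sup => // y /Ec/andP[].
have [y Ey] := E0; have /andP[y0 _] := Ec y Ey.
apply: (le_trans y0); apply: ub_le_sup => //.
by exists c => z /Ec/andP[].
Qed.

End Hilbert.

Theorem theorem3p3 (R : realType) (H : completeNormedModType R[i])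
    (dot : {dot H for Num.conj}) (dotE : forall x : H, dot x x = `|x| ^+ 2)
    (A B : H -> H) (bA : bounded_op A) (bB : bounded_op B)
    (r : R) (r_ge1 : 1 <= r) :
  numerical_radius dot (adjoint dot B \o A) `^ (2 * r) <=
  2^-1 * numerical_radius dot
    (fun x => op_powR (op_abs dot A) (2 * r) x
              + 'i *: op_powR (op_abs dot B) (2 * r) x) ^+ 2.
Proof.
have [bP sP] := op_abs_powR_bounded_selfadj dot dotE A r bA r_ge1.
have [bQ sQ] := op_abs_powR_bounded_selfadj dot dotE B r bB r_ge1.
have hP x := op_abs_powR_ge dot dotE A r x bA r_ge1.
have hQ x := op_abs_powR_ge dot dotE B r x bB r_ge1.
move: (op_powR _ _) bP sP hP => P bP sP hP.
move: (op_powR _ _) bQ sQ hQ => Q bQ sQ hQ.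
set C := fun x => P x + 'i *: Q x.
have r2 : 0 < 2 * r by lra.
have bC : bounded_op C.
  have [lP [K K0 PK]] := bounded_opE _ bP; have [lQ [L L0 QL]] := bounded_opE _ bQ.
  apply: (bounded_opI _ (K + L)) => [a x y|x].
    by rewrite /C lP lQ !scalerDr !scalerA (mulrC 'i) addrACA.
  rewrite (le_trans (nrD _ _))// mulrDl lerD//.
  by rewrite nrZ /= expr0n expr1n add0r sqrtr1 mul1r.
set w := numerical_radius dot C.
have key x : nr x = 1 -> (nr (A x) * nr (B x)) `^ (2 * r) <= 2^-1 * w ^+ 2.
  move=> x1; rewrite powRM ?nr_ge0//.
  set p := rdot dot (P x) x; set q := rdot dot (Q x) x.
  have wx : p ^+ 2 + q ^+ 2 <= w ^+ 2.
    have := numerical_radius_ge dot dotE C x bC x1; rewrite -/w.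
    have -> : dot (C x) x = p +i* q.
      have -> : dot (C x) x = dot (P x) x + 'i * dot (Q x) x.
        by rewrite /C linearDl/= linearZl_LR.
      by rewrite !selfadj_dot_real//; simpc.
    move=> h; rewrite -(@sqr_sqrtr _ (p ^+ 2 + q ^+ 2)) ?addr_ge0 ?sqr_ge0//.
    by rewrite ler_pXn2r ?nnegrE ?sqrtr_ge0// (le_trans _ h) ?sqrtr_ge0.
  apply: (@le_trans _ _ (p * q)).
    by apply: ler_pM; rewrite ?powR_ge0 ?hP ?hQ.
  have := sqr_ge0 (p - q); rewrite sqrrB; lra.
have c0 : 0 <= 2^-1 * w ^+ 2 by rewrite mulr_ge0 ?sqr_ge0.
move: (2^-1 * w ^+ 2) c0 key => c c0 key.
(* Writing [c] as a power reduces the claim to a bound on the numerical radius itself, which can be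
   checked vector by vector. *)
have cE : c = (c `^ (2 * r)^-1) `^ (2 * r).
  by rewrite -powRrM mulVf ?gt_eqF// powRr1.
have [_ adjB] := adjointP dot dotE B bB.
have /andP[v0 vc] : 0 <= numerical_radius dot (adjoint dot B \o A) <= c `^ (2 * r)^-1.
  apply: numerical_radius_le => [|x x1]; first exact: powR_ge0.
  have -> : dot ((adjoint dot B \o A) x) x = dot (A x) (B x).
    by rewrite dotC /= -adjB -dotC.
  apply: (le_trans (dot_cauchy_schwarz dot dotE _ _)).
  have n0 : 0 <= nr (A x) * nr (B x) by rewrite mulr_ge0 ?nr_ge0.
  have -> : nr (A x) * nr (B x) = ((nr (A x) * nr (B x)) `^ (2 * r)) `^ (2 * r)^-1.
    by rewrite -powRrM divff ?gt_eqF// powRr1.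
  by apply: ge0_ler_powR; rewrite ?nnegrE ?powR_ge0 ?key// invr_ge0 ltW.
by rewrite cE ge0_ler_powR ?nnegrE ?powR_ge0// ltW.
Qed.
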